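(* Let $q_1,\dots,q_8$ be the eight vertices $(\pm1,\pm1,\pm1)$ of a cube in $\mathbb{R}^3$, let $t\in(0,1)$ and let $q_{j+8}=tq_j$ for $j=1,\dots,8$. Suppose that positive masses $m_1,\dots,m_{16}$ placed at $q_1,\dots,q_{16}$ form a central configuration. Then $m_1=\dots=m_8$ and $m_9=\dots=m_{16}$.
   Context: A configuration $q=(q_1,\dots,q_N)$ of distinct points in $\mathbb{R}^3$ with masses $m_1,\dots,m_N$ is a central configuration if there exists $c\in\mathbb{R}$ such that $\sum_{j\neq i} m_j\left(\frac{1}{|q_j-q_i|^3}-c\right)(q_j-q_i)=0$ for all $i=1,\dots,N$. *)

(* Defs.v *)
From HB Require Import structures.
From mathcomp Require Import all_boot all_order all_algebra.
From mathcomp Require Import reals.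
Set Implicit Arguments. Unset Strict Implicit. Unset Printing Implicit Defensive.
Import Order.TTheory GRing.Theory Num.Theory.
Local Open Scope ring_scope.

Definition dist3 (R : realType) (x y : 'rV[R]_3) : R :=
  Num.sqrt (\sum_(k < 3) (x ord0 k - y ord0 k) ^+ 2).

Definition central_configuration (R : realType) (N : nat)
  (m : 'I_N -> R) (q : 'I_N -> 'rV[R]_3) : Prop :=
  (forall i j : 'I_N, i != j -> q i != q j) /\
  exists c : R, forall i : 'I_N,
    \sum_(j < N | j != i)
       (m j * ((dist3 (q j) (q i) ^+ 3)^-1 - c)) *: (q j - q i) = 0.

Definition cube_vertex (R : realType) (x : 'rV[R]_3) : Prop :=
  forall k : 'I_3, x ord0 k = 1 \/ x ord0 k = -1.

(* Main.v *)
Require Import Defs.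
From HB Require Import structures.
From mathcomp Require Import all_boot all_order all_algebra.
From mathcomp Require Import all_classical reals.
From mathcomp Require Import topology normedtype derive realfun exp ring lra.
Import Order.TTheory GRing.Theory Num.Theory.
Import numFieldNormedType.Exports.
Local Open Scope ring_scope.

(* Since the cube is the group (Z/2)^3, multiplying the k-th coordinate of the
   force on the vertex s by s_k and taking the Walsh transform in s decouples
   the equations: each character S gives linear equations in the two unknowns
   hat mu S and hat nu S (outer and inner masses).  For S <> 0 choose k so that
   the weights of S and of S with k flipped are {1,2} or {2,3}; then the unknown
   constant c cancels, and the 2x2 determinant is nonzero.  Indeed, if P > Q > 0
   are the two transforms of the outer-inner interaction at radius ratio t, then
   (t P - Q) (P - t Q) = t (P - Q)^2 - (1 - t)^2 P Q < t (P - Q)^2, and the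
   finite differences of the completely monotone function x^(-3/2) at
   3 (1 - t)^2 + 4 t d are smaller than those at 4 t d, which bounds
   (P - Q)^2 by the product of the same differences for the outer-outer and
   inner-inner interactions. *)

(* The bit [true] stands for the coordinate -1. *)
Definition cube : finType := (bool * bool * bool)%type.

Definition coord (s : cube) (k : 'I_3) : bool :=
  nth false [:: s.1.1; s.1.2; s.2] k.

Definition cadd (s r : cube) : cube :=
  (s.1.1 (+) r.1.1, s.1.2 (+) r.1.2, s.2 (+) r.2).

Definition wt (s : cube) : nat := s.1.1 + s.1.2 + s.2.

(** * Walsh analysis on the group (Z/2)^3 *)

Section Walsh.
Variable R : realFieldType.
Implicit Types (S s r : cube) (k : 'I_3) (f : cube -> R).

Definition sgn (s : cube) (k : 'I_3) : R := (-1) ^+ coord s k.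

Definition chi S s : R :=
  (-1) ^+ ((S.1.1 && s.1.1) (+) (S.1.2 && s.1.2) (+) (S.2 && s.2)).

Definition hat f S : R := \sum_s chi S s * f s.

Definition flip S k : cube :=
  cadd S (k == 0, k == 1, k == 2%:R).

Lemma chiD S s r : chi S (cadd s r) = chi S s * chi S r.
Proof.
rewrite /chi -signr_addb; congr (_ ^+ nat_of_bool _).
by case: S => [[[] []] []]; case: s => [[[] []] []]; case: r => [[[] []] []].
Qed.

Lemma sgnD s r k : sgn (cadd s r) k = sgn s k * sgn r k.
Proof. by rewrite /sgn -signr_addb; case: k => [[|[|[|]]]]. Qed.

Lemma chi_flip S s k : chi (flip S k) s = chi S s * sgn s k.
Proof.
rewrite /chi /sgn -signr_addb; congr (_ ^+ nat_of_bool _).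
by case: k => [[|[|[|//]]] ?]; case: S => [[[] []] []]; case: s => [[[] []] []].
Qed.

Lemma sgn_mul_self s k : sgn s k * sgn s k = 1.
Proof. by rewrite /sgn -signr_addb addbb. Qed.

Lemma caddK s : involutive (cadd s).
Proof. by case: s => [[a b] c] [[a' b'] c']; rewrite /cadd /= !addKb. Qed.

(** The transform turns convolution with [A] into a product. As [sgn] squares to 1, the outer factor
    [sgn s k] cancels in the [r] term and leaves the relative sign of [u] and [s] in the [p] term,
    which shifts the character to [flip S k]. *)
Lemma hat_conv S k (A : cube -> R) f (p r : R) :
  \sum_s chi S s * (sgn s k *
    \sum_u f u * (A (cadd u s) * (p * sgn u k - r * sgn s k))) =
  hat f S * (p * hat A (flip S k) - r * hat A S).
Proof.
under eq_bigr do rewrite mulrA mulr_sumr.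
rewrite exchange_big /hat mulr_suml; apply: eq_bigr => u _.
rewrite (reindex_inj (inv_inj (caddK u))) /= !mulr_sumr -sumrB mulr_sumr.
apply: eq_bigr => s _; rewrite caddK chiD sgnD chi_flip.
have := sgn_mul_self u k; have := sgn_mul_self s k.
move: (sgn u k) (sgn s k) (chi S u) (chi S s) => a b x y hb ha.
have -> : p * a - r * (a * b) = a * (p - r * b) by ring.
transitivity (f u * A s * x * y * (a * a) * (p * b - r * (b * b))); first by ring.
rewrite ha hb; ring.
Qed.

Lemma sum_cube f : \sum_s f s =
  f (false, false, false) + f (false, false, true) + f (false, true, false)
  + f (false, true, true) + f (true, false, false) + f (true, false, true)
  + f (true, true, false) + f (true, true, true).
Proof.
transitivity (\sum_(x : bool) \sum_(y : bool) \sum_(z : bool) f (x, y, z)).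
  by rewrite !pair_bigA; apply: eq_bigr => -[[]].
by rewrite !big_bool /=; ring.
Qed.

Lemma hat_inv f s : \sum_S chi S s * hat f S = 8%:R * f s.
Proof.
rewrite /hat !sum_cube /chi.
by case: s => [[[] []] []] /=; rewrite ?expr0 ?expr1; ring.
Qed.

(** By inversion only the trivial character, which is constant, contributes. *)
Lemma hat_const f : (forall S, wt S != 0%N -> hat f S = 0) ->
  forall s r, f s = f r.
Proof.
move=> h; have E s : 8%:R * f s = hat f (false, false, false).
  rewrite -hat_inv (bigD1 (false, false, false)) //= big1 ?addr0 => [|S hS].
    by rewrite /chi /= mul1r.
  by rewrite h ?mulr0 //; case: S hS => [[[] []] []].
by move=> s r; apply: (@mulfI _ 8%:R); rewrite ?pnatr_eq0 // !E.
Qed.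

(* Krawtchouk transform: the Walsh transform of a function of the weight. *)
Definition kraw (B : nat -> R) (n : nat) : R :=
  match n with
  | 0%N => B 0%N + 3 * B 1%N + 3 * B 2%N + B 3%N
  | 1%N => B 0%N + B 1%N - B 2%N - B 3%N
  | 2%N => B 0%N - B 1%N - B 2%N + B 3%N
  | _ => B 0%N - 3 * B 1%N + 3 * B 2%N - B 3%N
  end.

Lemma hat_wt (B : nat -> R) S : hat (B \o wt) S = kraw B (wt S).
Proof.
rewrite /hat sum_cube /chi /wt /=.
by case: S => [[[] []] []] /=; rewrite ?addn0 ?addn1 ?expr0 ?expr1 /=; ring.
Qed.

End Walsh.

Arguments kraw {R}.
Arguments hat {R}.

(** * Complete monotonicity of negative powers *)

Section PowerDifferences.
Variable R : realType.
Implicit Types (n : nat) (a h x y : R).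

(** The sign (-1)^n is built into the difference of order [n], so that complete monotonicity reads
    as positivity. *)
Fixpoint pdiff n a h x : R :=
  if n is n'.+1 then pdiff n' a h x - pdiff n' a h (x + h) else x `^ (- a).

Lemma is_derive_pdiff n a h x : 0 < x -> 0 <= h ->
  is_derive x 1 (pdiff n a h) (- a * pdiff n (a + 1) h x).
Proof.
move=> x0 h0; elim: n x x0 => [|n IHn] x x0 /=.
  by rewrite opprD; exact: is_derive1_powR.
have xh0 : 0 < x + h by rewrite ltr_pwDl.
have sh : is_derive (shift h x) 1 (pdiff n a h) (- a * pdiff n (a + 1) h (x + h)).
  exact: IHn.
have := is_derive1_comp sh (is_derive_shift x 1 h); rewrite mulr1 => shift_h.
rewrite mulrBr; exact: (is_deriveB (IHn x x0) shift_h).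
Qed.

(** Mean value theorem. Positivity is kept as a hypothesis because the induction for [pdiff_gt0]
    runs through this lemma. *)
Lemma pdiff_decr_of_gt0 n a h : 0 < a -> 0 <= h ->
  (forall x, 0 < x -> 0 < pdiff n (a + 1) h x) ->
  forall x y, 0 < x -> x < y -> pdiff n a h y < pdiff n a h x.
Proof.
move=> a0 h0 pos x y x0 xy.
have der z : x <= z -> is_derive z 1 (pdiff n a h) (- a * pdiff n (a + 1) h z).
  by move=> xz; apply: is_derive_pdiff => //; exact: lt_le_trans xz.
have cont : {within `[x, y], continuous (pdiff n a h)}%classic.
  apply: derivable_within_continuous => w.
  by rewrite in_itv /= => /andP[xw _]; have [] := der w xw.
have der_in z : z \in `]x, y[ ->
    is_derive z 1 (pdiff n a h) (- a * pdiff n (a + 1) h z).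
  by rewrite in_itv /= => /andP[/ltW xz _]; exact: der.
have [z + E] := MVT xy der_in cont; rewrite in_itv /= => /andP[xz _].
rewrite -subr_lt0 E mulNr mulNr oppr_lt0 !mulr_gt0 ?subr_gt0 ?pos //.
exact: lt_trans xz.
Qed.

(** Induction on [n] for all [a]: positivity at order [n] and exponent [a + 1] makes the difference
    of order [n] at [a] decrease, which is positivity at order [n + 1]. *)
Lemma pdiff_gt0 n a h x : 0 < a -> 0 < h -> 0 < x -> 0 < pdiff n a h x.
Proof.
move=> + h0; elim: n a x => [|n IHn] a x a0 x0 /=; first exact: powR_gt0.
rewrite subr_gt0; apply: pdiff_decr_of_gt0; rewrite ?ltrDl // ?ltW // => y y0.
by apply: IHn => //; rewrite addr_gt0.
Qed.

Lemma pdiff_decr n a h x y : 0 < a -> 0 < h -> 0 < x -> x < y ->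
  pdiff n a h y < pdiff n a h x.
Proof.
move=> a0 h0; apply: pdiff_decr_of_gt0 => // [|z z0]; first exact: ltW.
by apply: pdiff_gt0 => //; rewrite addr_gt0.
Qed.

End PowerDifferences.

Arguments pdiff_gt0 {R} n {a h x}.
Arguments pdiff_decr {R} n {a h x y}.

(** * Interaction kernels and the determinant inequality *)

Section Kernels.
Variable R : realType.
Implicit Types (c p r t x y : R).

Definition phi x : R := x `^ (- (3 / 2)).

Lemma phiE x : 0 <= x -> phi x = (Num.sqrt x ^+ 3)^-1.
Proof.
move=> x0; rewrite /phi powRN -powR12_sqrt // -powR_mulrn ?powR_ge0 //.
by rewrite -powRrM mulrC.
Qed.

Lemma phiM x y : 0 <= x -> 0 <= y -> phi (x * y) = phi x * phi y.
Proof. exact: powRM. Qed.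

(* [3 (p - r)^2 + 4 p r d] is the squared distance between [p *: u] and [r *: s]
   for cube vertices u, s differing in d coordinates. *)
Definition kernel c p r (d : nat) : R :=
  phi (3 * (p - r) ^+ 2 + 4 * p * r * d%:R) - c.

Lemma mixed_prod_lt t P Q E : 0 < t < 1 -> 0 < Q -> Q < P -> P - Q < E ->
  (t * P - Q) * (P - t * Q) < t * E ^+ 2.
Proof.
move=> /andP[t0 t1] Q0 QP DE.
have -> : (t * P - Q) * (P - t * Q) = t * (P - Q) ^+ 2 - (1 - t) ^+ 2 * (Q * P).
  by ring.
have sq : (P - Q) ^+ 2 < E ^+ 2.
  rewrite ltr_pXn2r ?nnegrE ?subr_ge0 ?(ltW QP) //.
  by rewrite (le_trans _ (ltW DE)) // subr_ge0 ltW.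
have : t * (P - Q) ^+ 2 < t * E ^+ 2 by rewrite ltr_pM2l.
have : 0 <= (1 - t) ^+ 2 * (Q * P).
  by rewrite mulr_ge0 ?sqr_ge0 // mulr_ge0 ?ltW // (lt_trans Q0).
lra.
Qed.

Lemma kraw_det c t (n : nat) : 0 < t < 1 -> (n == 1%N) || (n == 2%N) ->
  (t * kraw (kernel c t 1) n - kraw (kernel c t 1) n.+1)
  * (kraw (kernel c t 1) n - t * kraw (kernel c t 1) n.+1) <
  t * ((kraw (kernel c 1 1) n - kraw (kernel c 1 1) n.+1)
  * (kraw (kernel c t t) n - kraw (kernel c t t) n.+1)).
Proof.
move=> t01 n12; have /andP[t0 t1] := t01.
pose x := 3 * (t - 1) ^+ 2; pose h := 4 * t.
have x0 : 0 < x.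
  by rewrite mulr_gt0 // exprn_even_gt0 //= subr_eq0 lt_eqF.
have h0 : 0 < h by rewrite mulr_gt0.
have a0 : 0 < 3 / 2 :> R by lra.
have kt d : kernel c t 1 d = phi (x + h * d%:R) - c.
  by rewrite /kernel mulr1.
have k1 d : kernel c 1 1 d = phi (4 * d%:R) - c.
  by rewrite /kernel subrr expr0n mulr0 add0r !mulr1.
have d40 (d : nat) : 0 <= 4 * d%:R :> R by rewrite mulr_ge0.
have ktt d : kernel c t t d = phi t ^+ 2 * phi (4 * d%:R) - c.
  rewrite /kernel subrr expr0n mulr0 add0r expr2 -mulrA.
  rewrite -!phiM ?mulr_ge0 ?d40 ?(ltW t0) //; congr (phi _ - _); ring.
(* The values at [h * d] are geometric means of the outer-outer and inner-inner values; twice their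
   differences serve as [E] in [mixed_prod_lt]. *)
have phih (d : nat) : phi (h * d%:R) = phi t * phi (4 * d%:R).
  by rewrite -phiM ?d40 ?ltW //; congr phi; rewrite /h; ring.
have d3 z : pdiff R 3 (3 / 2) h z =
    pdiff R 2 (3 / 2) h z - pdiff R 2 (3 / 2) h (z + h).
  by [].
have d2 z : pdiff R 2 (3 / 2) h z =
    phi z - phi (z + h) - (phi (z + h) - phi (z + h + h)).
  by [].
have d1 z : pdiff R 1 (3 / 2) (h + h) z = phi z - phi (z + (h + h)) by [].
have h20 : 0 < h + h by rewrite addr_gt0.
have xh : h < x + h by rewrite ltrDr.
(* With P and Q the mixed transforms at [n] and [n.+1], [G3], [G2] and [D1] give 0 < Q < P, while
   [E1] (for n = 1) and [E2] (for n = 2) bound P - Q. *)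
have G3 := pdiff_gt0 3 a0 h0 x0.
have G2 := pdiff_gt0 2 a0 h0 (addr_gt0 x0 h0).
have D1 := pdiff_gt0 1 a0 h20 (addr_gt0 x0 h0).
have E2 := pdiff_decr 2 a0 h0 h0 xh.
have E1 := pdiff_decr 1 a0 h20 h0 xh.
move: G3 G2 D1 E1 E2; rewrite d3 !d2 !d1.
have -> : x + h + h + h = x + h * 3%:R by ring.
have -> : x + h + (h + h) = x + h * 3%:R by ring.
have -> : x + h + h = x + h * 2%:R by ring.
have -> : h + (h + h) = h * 3%:R by ring.
have -> : h + h + h = h * 3%:R by ring.
have -> : h + h = h * 2%:R by ring.
have -> : phi (x + h) = phi (x + h * 1%:R) by rewrite mulr1.
have -> : phi h = phi (h * 1%:R) by rewrite mulr1.
have -> : phi x = phi (x + h * 0%:R) by rewrite mulr0 addr0.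
rewrite !phih => G3 G2 D1 E1 E2.
(* On expansion [c] cancels, and so does [f0], the default value of [phi] at 0. *)
case/orP: n12 => /eqP->; rewrite /kraw !kt !k1 !ktt; move: G3 G2 D1 E1 E2;
  move: (phi (x + h * 0%:R)) (phi (x + h * 1%:R)) (phi (x + h * 2%:R))
    (phi (x + h * 3%:R)) (phi t) (phi (4 * 0%:R)) (phi (4 * 1%:R))
    (phi (4 * 2%:R)) (phi (4 * 3%:R)) => g0 g1 g2 g3 s f0 f1 f2 f3 *.
- rewrite [ltRHS](_ : _ = t * (2 * (s * f1 - s * f3)) ^+ 2); last by ring.
  by apply: mixed_prod_lt; lra.
- rewrite [ltRHS](_ : _ = t * (2 * (s * f1 - s * f2 - (s * f2 - s * f3))) ^+ 2);
    last by ring.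
  by apply: mixed_prod_lt; lra.
Qed.

End Kernels.

(** * Force equations on the two cubes *)

Section CubeEquations.
Variable R : realType.
Implicit Types (c p r t : R) (mu nu : cube -> R) (S s u : cube) (k : 'I_3).

Definition vert s : 'rV[R]_3 := \row_k sgn R s k.

(** A coordinate contributes (p - r)^2 if the signs agree and (p + r)^2 = (p - r)^2 + 4 p r if not.
    For coincident points both sides are 0 by default. *)
Lemma dist3_vert p r u s : 0 < p -> 0 < r ->
  (dist3 (p *: vert u) (r *: vert s) ^+ 3)^-1 =
  phi R (3 * (p - r) ^+ 2 + 4 * p * r * (wt (cadd u s))%:R).
Proof.
move=> p0 r0; rewrite phiE; last first.
  by rewrite addr_ge0 // pmulr_rge0 ?sqr_ge0 ?ler0n // !mulr_gt0.
congr ((Num.sqrt _ ^+ 3)^-1).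
under eq_bigr do rewrite !mxE.
rewrite !big_ord_recl big_ord0 /sgn /coord /wt /=.
case: u => [[u1 u2] u3]; case: s => [[s1 s2] s3] /=; rewrite !natrD.
have E b b' : (p * (-1) ^+ nat_of_bool b - r * (-1) ^+ nat_of_bool b') ^+ 2 =
    (p - r) ^+ 2 + 4 * p * r * (b (+) b')%:R.
  by case: b; case: b' => /=; rewrite ?expr0 ?expr1; ring.
by rewrite !E; ring.
Qed.

(** The pair of weights avoids 0, the only weight at which [c] survives in [kraw]. *)
Lemma flip_wt S : wt S != 0%N -> exists k, exists2 n, (n == 1%N) || (n == 2%N) &
  wt S = n /\ wt (flip S k) = n.+1 \/ wt S = n.+1 /\ wt (flip S k) = n.
Proof.
case: S => [[[] []] []] // _;
  [exists 0, 2%N | exists 0, 1%N | exists 0, 1%N | exists 1, 1%N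
  | exists 1, 1%N | exists 0, 1%N | exists 0, 1%N] => //; by [left | right].
Qed.

Lemma eq0_of_det_gt0 (t a b u v x y : R) : u * v < t * (a * b) ->
  x * a + y * u = 0 -> x * v + y * (t * b) = 0 -> x = 0 /\ y = 0.
Proof.
rewrite -subr_gt0 => /lt0r_neq0 det0 E1 E2; split;
  apply: (mulIf det0); rewrite mul0r.
  transitivity (t * b * (x * a + y * u) - u * (x * v + y * (t * b))); first by ring.
  by rewrite E1 E2; ring.
transitivity (a * (x * v + y * (t * b)) - v * (x * a + y * u)); first by ring.
by rewrite E1 E2; ring.
Qed.

Definition force c p r mu s k : R :=
  \sum_u mu u * (kernel R c p r (wt (cadd u s)) * (p * sgn R u k - r * sgn R s k)).

Lemma hat_force c p r mu S k :
  \sum_s chi R S s * (sgn R s k * force c p r mu s k) =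
  hat mu S * (p * kraw (kernel R c p r) (wt (flip S k))
              - r * kraw (kernel R c p r) (wt S)).
Proof. by rewrite -!hat_wt -(hat_conv R S k (kernel R c p r \o wt)). Qed.

Lemma kernelC c p r : kernel R c p r = kernel R c r p.
Proof. by apply: funext => d; rewrite /kernel; congr (phi _ _ - _); ring. Qed.

Lemma hat_eq0 c t mu nu : 0 < t < 1 ->
  (forall s k, force c 1 1 mu s k + force c t 1 nu s k = 0) ->
  (forall s k, force c 1 t mu s k + force c t t nu s k = 0) ->
  forall S, wt S != 0%N -> hat mu S = 0 /\ hat nu S = 0.
Proof.
move=> t01 outer inner S /flip_wt[k [n n12 wtS]].
have transform r : (forall s k, force c 1 r mu s k + force c t r nu s k = 0) ->
    hat mu S * (1 * kraw (kernel R c 1 r) (wt (flip S k))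
                - r * kraw (kernel R c 1 r) (wt S)) +
    hat nu S * (t * kraw (kernel R c t r) (wt (flip S k))
                - r * kraw (kernel R c t r) (wt S)) = 0.
  move=> bal; rewrite -!hat_force -big_split big1 // => s _ /=.
  by rewrite -!mulrDr bal !mulr0.
have := transform _ inner; have := transform _ outer.
rewrite (kernelC c 1 t) !mul1r -!mulrBr.
apply: eq0_of_det_gt0.
(* Exchanging the two weights negates both diagonal differences and swaps the mixed factors up to
   sign, so one inequality covers both cases. *)
have := kraw_det _ c _ _ t01 n12.
by case: wtS => -[-> ->] /=; lra.
Qed.

(** The diagonal term vanishes, so it can be restored; full sums are easier to reindex. *)
Lemma central_configuration_coord N (m : 'I_N -> R) (q : 'I_N -> 'rV[R]_3) :
  central_configuration m q -> exists c, forall i k,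
    \sum_j m j * (((dist3 (q j) (q i) ^+ 3)^-1 - c)
                  * (q j ord0 k - q i ord0 k)) = 0.
Proof.
move=> [_ [c bal]]; exists c => i k.
rewrite (bigD1 i) //= subrr !mulr0 add0r.
have /(congr1 (fun v : 'rV[R]_3 => v ord0 k)) := bal i.
rewrite summxE mxE => E; rewrite -[RHS]E.
by apply: eq_bigr => j _; rewrite !mxE mulrA.
Qed.

(** Reading off signs is an injection between sets of eight elements, hence a bijection. *)
Lemma cube_labelling (v : 'I_8 -> 'rV[R]_3) :
  (forall i, cube_vertex (v i)) -> injective v ->
  exists2 g : cube -> 'I_8, bijective g & forall s, v (g s) = vert s.
Proof.
move=> cv v_inj.
pose l i : cube := (v i ord0 0 == -1, v i ord0 1 == -1, v i ord0 2%:R == -1).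
have vert_l i : v i = vert (l i).
  have N1 : (1 == -1 :> R) = false by apply/eqP; lra.
  apply/rowP => k; rewrite mxE /sgn /coord /=.
  have -> : nth false [:: v i ord0 0 == -1; v i ord0 1 == -1;
      v i ord0 2%:R == -1] k = (v i ord0 k == -1).
    case: k => [[|[|[|//]]] Hk] /=; congr (v i ord0 _ == _); exact/val_inj.
  by have [->|->] := cv i k; rewrite ?N1 ?eqxx ?expr0 ?expr1.
have l_inj : injective l by move=> i j E; apply: v_inj; rewrite !vert_l E.
have [g lK gK] : bijective l.
  by apply: inj_card_bij l_inj _; rewrite !card_prod card_bool card_ord.
by exists g; [exists l | move=> s; rewrite vert_l gK].
Qed.

End CubeEquations.

(* Index i : 'I_8 corresponds to q_{i+1} (lshift 8 i) and q_{i+9} (rshift 8 i). *)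
Theorem theorem12 (R : realType) (t : R) (q : 'I_(8 + 8) -> 'rV[R]_3)
  (m : 'I_(8 + 8) -> R) :
  0 < t < 1 ->
  (forall i : 'I_8, cube_vertex (q (lshift 8 i))) ->
  (forall i j : 'I_8, q (lshift 8 i) = q (lshift 8 j) -> i = j) ->
  (forall i : 'I_8, q (rshift 8 i) = t *: q (lshift 8 i)) ->
  (forall i, 0 < m i) ->
  central_configuration m q ->
  (forall i j : 'I_8, m (lshift 8 i) = m (lshift 8 j)) /\
  (forall i j : 'I_8, m (rshift 8 i) = m (rshift 8 j)).
Proof.
move=> t01 cubeq q_inj q_inner _ /central_configuration_coord[c bal].
have /andP[t0 _] := t01.
have [g g_bij q_outer] := cube_labelling R _ cubeq q_inj.
pose mu s := m (lshift 8 (g s)); pose nu s := m (rshift 8 (g s)).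
(* One statement serves both cubes: [r] is 1 for an outer body and [t] for an inner one. *)
have force_sum (a : 'I_(8 + 8)) r s k : 0 < r -> q a = r *: vert R s ->
    force R c 1 r mu s k + force R c t r nu s k = 0.
  move=> r0 qa; rewrite -(bal a k) big_split_ord /=.
  rewrite !(reindex g) /=; try exact: onW_bij.
  congr (_ + _); apply: eq_bigr => u _.
    by rewrite q_outer qa -[vert R u]scale1r dist3_vert // !mxE.
  by rewrite q_inner q_outer qa dist3_vert // !mxE.
have hat0 S : wt S != 0%N -> hat mu S = 0 /\ hat nu S = 0.
  apply: (hat_eq0 R c t) => // s k.
    by apply: (force_sum (lshift 8 (g s))) => //; rewrite scale1r q_outer.
  by apply: (force_sum (rshift 8 (g s))) => //; rewrite q_inner q_outer.
case: g_bij => l lK gK.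
have mu_const := hat_const R mu (fun S h => (hat0 S h).1).
have nu_const := hat_const R nu (fun S h => (hat0 S h).2).
split=> i j.
  by have := mu_const (l i) (l j); rewrite /mu !gK.
by have := nu_const (l i) (l j); rewrite /nu !gK.
Qed.
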